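(* For $L=3$, all coefficients of the formal power series $G_{L,2}(q)+q^3+q^9+q^{15}$ are nonnegative.
   Context: A partition $\pi$ is a weakly decreasing finite list of positive integers (its parts); $|\pi|$ denotes the sum of its parts. Let $\mho$ be the set of partitions $\pi$ with $|\pi|>0$, and for $\pi \in \mho$ let $s(\pi)$ and $l(\pi)$ denote the smallest and largest parts of $\pi$, respectively. For a positive integer $L$, define $$G_{L,2}(q) = \sum_{\substack{\pi \in \mho,\\ s(\pi)=2,\\ l(\pi)-s(\pi)\leq L}} q^{|\pi|} - \sum_{\substack{\pi \in \mho,\\ s(\pi)\geq 3,\\ l(\pi)-s(\pi)\leq L}} q^{|\pi|}.$$ *)

(* Defs.v *)
From HB Require Import structures.
From mathcomp Require Import all_boot all_order all_algebra finmap.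
From mathcomp Require Import boolp classical_sets functions cardinality fsbigop.

Set Implicit Arguments.
Unset Strict Implicit.
Unset Printing Implicit Defensive.

Import Order.TTheory GRing.Theory Num.Theory.

Local Open Scope classical_set_scope.
Local Open Scope ring_scope.

Definition is_partition (s : seq nat) : bool :=
  sorted geq s && all (ltn 0) s.

Record partition := Partition { parts :> seq nat; _ : is_partition parts }.

HB.instance Definition _ := [isSub for parts].
HB.instance Definition _ := [Choice of partition by <:].

Definition psize (p : partition) : nat := sumn p.

(* Parts are listed in weakly decreasing order, so the first one is the largest
   and the last one is the smallest; the value 0 on the empty partition is
   irrelevant, as the empty partition is not in mho. *)
Definition largest (p : partition) : nat := head 0%N p.
Definition smallest (p : partition) : nat := last 0%N p.

Definition mho : set partition := [set p | (0 < psize p)%N].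

(* A formal power series over the integers is its sequence of coefficients;
   only its additive structure, which is coefficientwise, is needed. *)
Definition fps : Type := nat -> int.
HB.instance Definition _ := GRing.Zmodule.on fps.

Definition coef (f : fps) (n : nat) : int := f n.

Definition qpow (k : nat) : fps := fun n => (n == k)%:R.

(* The sum of a family of power series, taken coefficient by coefficient.
   The finitely supported sum is 0 when infinitely many members of the family
   contribute to a coefficient; for the series G below this does not happen,
   by finite_psize. *)
Definition fps_sum (I : choiceType) (A : set I) (F : I -> fps) : fps :=
  fun n => \sum_(i \in A) coef (F i) n.

Definition G (L s : nat) : fps :=
  fps_sum [set p | [/\ mho p, smallest p = s & (largest p - smallest p <= L)%N]]
    (fun p => qpow (psize p))
  - fps_sum [set p | [/\ mho p, (s.+1 <= smallest p)%N
                       & (largest p - smallest p <= L)%N]]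
    (fun p => qpow (psize p)).

Lemma finite_psize (n : nat) : finite_set [set p | psize p = n].
Proof.
have p0P : is_partition [::] by [].
pose g (b : {bseq n of 'I_n.+1}) : partition :=
  insubd (Partition p0P) (map val b).
apply: (@sub_finite_set _ _ (g @` setT)); last first.
  by apply: finite_image; exact: finite_finset.
move=> p /= sp.
have ppos : all (ltn 0) p by case: p {sp} => s /= /andP[].
have sz : (size p <= n)%N.
  rewrite -sp /psize; elim: (parts p) ppos => //= x s IH /andP[x0 /IH h].
  by rewrite -add1n leq_add.
have le x : x \in parts p -> (x < n.+1)%N.
  rewrite ltnS -sp /psize; elim: (parts p) => //= y s IH.
  rewrite inE => /orP[/eqP->|/IH h]; first exact: leq_addr.
  exact: leq_trans h (leq_addl _ _).
have szb : (size (map (@inord n) p) <= n)%N by rewrite size_map.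
exists (Bseq szb) => //; apply: val_inj; rewrite val_insubd /=.
have -> : map val (map (@inord n) p) = p.
  rewrite -map_comp -[RHS]map_id; apply/eq_in_map => x /le xn /=.
  by rewrite inordK.
by case: p {sp ppos sz le szb} => s /= ->.
Qed.

(* Main.v *)
From HB Require Import structures.
From mathcomp Require Import all_boot all_order all_algebra.
From mathcomp Require Import boolp classical_sets cardinality fsbigop.
From mathcomp Require Import zify ring.
Require Import Defs.

(** Write [a_k] for the series [1 / (1 - q^k)].  The idea is to turn the series
    [G 3 2] into a rational function of [q] whose denominator is a product of
    factors [1 - q^k], and then to rewrite the corrected series as a sum of
    seven products of powers of [q] and of series [a_k], which has nonnegative
    coefficients for an obvious reason.

    The first sum counts partitions with parts in {2,3,4,5}, one of them
    being 2, and equals [q^2 a_2 a_3 a_4 a_5] ([GE], [gf_parts_in_geom]).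
    The second sum, over all smallest parts [s >= 3], telescopes
    ([gf_bounded_diff]): as
    [q^s (1 - q^L) = (1 - q^(s+L)) - (1 - q^s)], multiplying by [1 - q^L] the
    series [q^s / ((1 - q^s) ... (1 - q^(s+L)))] of the partitions with smallest
    part [s] and largest part at most [s + L] gives the difference of two
    consecutive terms of the sequence [1 / ((1 - q^s) ... (1 - q^(s+L-1)))],
    which tends to 1.  For [L = 3] the second sum is therefore
    [a_3 (a_3 a_4 a_5 - 1)].

    Since [q^2 a_2 - a_3 = -1 + (q^2 - q^3 + q^4) a_6], it follows that
    [G 3 2 = (q^2 - q^3 - q^5 + q^9 + q^10 + q^11 - q^15) a_3 a_4 a_5 a_6].
    The numerator takes the positive value 1 at [q = 1], so that the
    coefficients eventually grow like a positive cubic; the only negative ones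
    are the coefficients -1 of [q^3], [q^9] and [q^15].  Looking for a way to
    write the corrected series as a nonnegative combination of the series
    [q^i] times a product of some of the [a_3, a_4, a_5, a_6] is a linear
    feasibility problem, and [corrected_series_identity] is an integral
    solution of it.

    To make this algebra available, formal power series are given their
    commutative ring structure. *)

Set Implicit Arguments.
Unset Strict Implicit.
Unset Printing Implicit Defensive.

Import Order.TTheory GRing.Theory Num.Theory.
Local Open Scope classical_set_scope.
Local Open Scope ring_scope.

(** * The ring of formal power series *)

Definition fps_mul (f g : fps) : fps :=
  fun n => \sum_(i < n.+1) f i * g (n - i)%N.

Definition fps_trunc (N : nat) (f : fps) : {poly int} := \poly_(i < N) f i.

Lemma fps_truncE N (f : fps) i : (i < N)%N -> f i = (fps_trunc N f)`_i.
Proof. by move=> iN; rewrite coef_poly iN. Qed.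

(** A coefficient of a product only depends on the coefficients of the factors
    up to the same degree; this reduces the ring axioms for series to those for
    polynomials. *)
Lemma fps_mul_poly (f g : fps) (p r : {poly int}) n :
    (forall i, (i <= n)%N -> f i = p`_i) ->
    (forall i, (i <= n)%N -> g i = r`_i) ->
  fps_mul f g n = (p * r)`_n.
Proof.
move=> fp gr; rewrite coefM; apply: eq_bigr => i _.
by rewrite fp ?gr ?leq_subr // -ltnS.
Qed.

Lemma fps_mul_trunc N (f g : fps) n : (n < N)%N ->
  fps_mul f g n = (fps_trunc N f * fps_trunc N g)`_n.
Proof.
by move=> nN; apply: fps_mul_poly => i ?; apply: fps_truncE; apply: leq_ltn_trans nN.
Qed.

Lemma fps_mulC : commutative fps_mul.
Proof.
by move=> f g; apply/funext => n; rewrite !(@fps_mul_trunc n.+1) // mulrC.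
Qed.

Lemma fps_mulA : associative fps_mul.
Proof.
move=> f g h; apply/funext => n.
have trE e i : (i <= n)%N -> e i = (fps_trunc n.+1 e)`_i.
  by move=> ?; apply: fps_truncE.
have mulE e e' i : (i <= n)%N ->
    fps_mul e e' i = (fps_trunc n.+1 e * fps_trunc n.+1 e')`_i.
  by move=> ?; apply: fps_mul_trunc.
by rewrite (fps_mul_poly (trE f) (mulE g h)) mulrA
           (fps_mul_poly (mulE f g) (trE h)).
Qed.

Lemma fps_mul1 : left_id (qpow 0) fps_mul.
Proof.
move=> f; apply/funext => n; rewrite /fps_mul big_ord_recl subn0 mul1r.
by rewrite big1 ?addr0 // => i _; rewrite mul0r.
Qed.

Lemma fps_mulDl : left_distributive fps_mul +%R.
Proof.
move=> f g h; apply/funext => n.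
by rewrite -[RHS]big_split; apply: eq_bigr => i _; rewrite mulrDl.
Qed.

Lemma qpow0_neq0 : qpow 0 != 0.
Proof. by apply/eqP => /(congr1 (@^~ 0%N)). Qed.

HB.instance Definition _ := GRing.Zmodule_isComNzRing.Build fps
  fps_mulA fps_mulC fps_mul1 fps_mulDl qpow0_neq0.

Lemma fpsD (f g : fps) n : (f + g) n = f n + g n. Proof. by []. Qed.
Lemma fpsN (f : fps) n : (- f) n = - f n. Proof. by []. Qed.
Lemma fpsM (f g : fps) n : (f * g) n = \sum_(i < n.+1) f i * g (n - i)%N.
Proof. by []. Qed.

Lemma qpow_mulE k (f : fps) n :
  (qpow k * f) n = if (k <= n)%N then f (n - k)%N else 0.
Proof.
rewrite fpsM; case: leqP => kn.
  rewrite (bigD1 (inord k)) //= inordK // /qpow eqxx mul1r big1 ?addr0 // => i.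
  by rewrite -val_eqE /= inordK // => /negbTE->; rewrite mul0r.
rewrite big1 // => i _; rewrite /qpow ltn_eqF ?mul0r //.
exact: leq_trans (ltn_ord i) kn.
Qed.

Lemma qpowE k : qpow k = qpow 1 ^+ k.
Proof.
elim: k => [|k IHk]; first by rewrite expr0.
rewrite exprS -IHk; apply/funext => n; rewrite qpow_mulE /qpow.
by case: n => // n; rewrite subn1.
Qed.

Lemma qpowD a b : qpow (a + b) = qpow a * qpow b.
Proof. by rewrite (qpowE (a + b)) (qpowE a) (qpowE b) exprD. Qed.

(** The geometric series [1 + q^k + q^(2k) + ...]. *)
Definition geom (k : nat) : fps := fun n => (k %| n)%:R.

Lemma geomP k : (0 < k)%N -> (1 - qpow k) * geom k = 1.
Proof.
move=> k0; rewrite mulrBl mul1r; apply/funext => n; rewrite fpsD fpsN qpow_mulE.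
rewrite [RHS]/(n == 0)%:R /geom; case: leqP => kn.
  by rewrite dvdn_subl // subrr; case: n kn => //; rewrite leqNgt k0.
case: n kn => [|n] kn; first by rewrite dvdn0 subr0.
by rewrite gtnNdvd // subr0.
Qed.

Definition nonneg (f : fps) := forall n, 0 <= f n.

Lemma nonnegD f g : nonneg f -> nonneg g -> nonneg (f + g).
Proof. by move=> f0 g0 n; rewrite addr_ge0. Qed.

Lemma nonnegM f g : nonneg f -> nonneg g -> nonneg (f * g).
Proof. by move=> f0 g0 n; apply: sumr_ge0 => i _; rewrite mulr_ge0. Qed.

Lemma nonneg_qpow k : nonneg (qpow k).
Proof. by move=> n; rewrite ler0n. Qed.

Lemma nonneg_geom k : nonneg (geom k).
Proof. by move=> n; rewrite ler0n. Qed.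

(** * Parts of a partition *)

Lemma partP (p : partition) : is_partition p.
Proof. exact: valP. Qed.

Lemma eq_part (p r : partition) : perm_eq p r -> p = r.
Proof.
move=> pr; apply/val_inj/(@sorted_eq _ geq _ _ _ _ _ _ pr).
- by move=> y x z; rewrite /= => xy yz; apply: leq_trans yz xy.
- by move=> x y; rewrite /= andbC => /anti_leq.
- by case/andP: (partP p).
- by case/andP: (partP r).
Qed.

Lemma psize_eq0 (p : partition) : psize p = 0%N -> parts p = [::].
Proof. by case: p => [[|[|x] s] //= /andP[_ //]]. Qed.

Lemma smallest_mem p : mho p -> smallest p \in parts p.
Proof.
rewrite /mho /= /psize /smallest; case: (parts p) => //= x s _.
exact: mem_last.
Qed.

Lemma largest_mem p : mho p -> largest p \in parts p.
Proof.
rewrite /mho /= /psize /largest; case: (parts p) => //= x s _.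
exact: mem_head.
Qed.

Lemma part_le_largest p i : i \in parts p -> (i <= largest p)%N.
Proof.
have /andP[] := partP p; rewrite /largest; case: (parts p) => // x s /= xs _.
rewrite inE => /predU1P[->//|]; apply/allP: i.
by apply: order_path_min xs => a b c /= ba cb; apply: leq_trans cb ba.
Qed.

Lemma smallest_le_part p i : i \in parts p -> (smallest p <= i)%N.
Proof.
have /andP[] := partP p; rewrite /smallest; elim/last_ind: (parts p) => // s x _.
rewrite last_rcons -rev_sorted rev_rcons /= => xs _.
rewrite mem_rcons inE => /predU1P[->//|]; rewrite -mem_rev; apply/allP: i.
by apply: order_path_min xs; apply: leq_trans.
Qed.

Lemma part_le_psize (p : partition) i : i \in parts p -> (i <= psize p)%N.
Proof.
rewrite /psize; elim: (parts p) => //= x s IH; rewrite inE => /predU1P[->|/IH].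
  exact: leq_addr.
by move=> h; apply: leq_trans h (leq_addl _ _).
Qed.

Lemma mho_mem p i : i \in parts p -> mho p.
Proof.
move=> ip; apply: contraTT ip; rewrite -eqn0Ngt => /eqP /psize_eq0 ->.
by rewrite in_nil.
Qed.

(** The default value [p] is only reached for [k = 0], which is not a legal
    part. *)
Definition add_part (k : nat) (p : partition) : partition :=
  insubd p (sort geq (k :: p)).

Lemma perm_add_part k p : (0 < k)%N -> perm_eq (add_part k p) (k :: p).
Proof.
move=> k0; rewrite [parts _]val_insubd /is_partition sort_sorted; last first.
  by move=> x y; apply: leq_total.
by rewrite all_sort /= k0; case/andP: (partP p) => _ ->; rewrite perm_sort.
Qed.

Lemma psize_add_part k p : (0 < k)%N -> psize (add_part k p) = (k + psize p)%N.
Proof. by move=> k0; rewrite /psize (perm_sumn (perm_add_part p k0)). Qed.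

Lemma add_part_inj k : (0 < k)%N -> injective (add_part k).
Proof.
move=> k0 p r /(congr1 parts) e; apply: eq_part; rewrite -(perm_cons k).
by rewrite -(permPl (perm_add_part p k0)) e perm_add_part.
Qed.

Lemma mem_part k (p : partition) : k \in parts p -> exists r, add_part k r = p.
Proof.
move=> kp; have /andP[ps p0] := partP p.
have rP : is_partition (rem k p).
  apply/andP; split; last by apply/allP => x /mem_rem; apply: (allP p0).
  apply: subseq_sorted (rem_subseq k p) ps => y x z /= xy yz.
  exact: leq_trans yz xy.
exists (Partition rP); apply: eq_part.
have k0 : (0 < k)%N by apply: (allP p0).
by rewrite (permPl (perm_add_part _ k0)) perm_sym perm_to_rem.
Qed.

(** * Generating functions of sets of partitions *)

Definition gf (A : set partition) : fps := fps_sum A (fun p => qpow (psize p)).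

Lemma gf_coefE A n : gf A n =
  \sum_(p \in A `&` [set p | psize p = n]) (1 : int).
Proof.
rewrite fsbig_mkcondr; apply: eq_fsbigr => p _.
by rewrite /coef /qpow /= eq_sym; case: eqP => [pn|/eqP pn];
  [rewrite mem_set | rewrite memNset //; apply/eqP].
Qed.

Lemma gf_coef0 A n : (forall p, A p -> psize p != n) -> gf A n = 0.
Proof.
move=> An; apply: fsbig1 => p /An; rewrite /coef /qpow eq_sym.
by move=> /negbTE->.
Qed.

Lemma gfU A B : A `&` B = set0 -> gf (A `|` B) = gf A + gf B.
Proof.
move=> AB0; apply/funext => n; rewrite fpsD !gf_coefE setIUl fsbigU0 //.
1,2: exact: sub_finite_set (@subIsetr _ _ _) (finite_psize n).
by rewrite setIACA AB0 set0I.
Qed.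

Lemma gf_image h k A :
    (forall p, psize (h p) = k + psize p)%N -> injective h ->
  gf (h @` A) = qpow k * gf A.
Proof.
move=> hk hI; apply/funext => n; rewrite qpow_mulE [LHS]fsbig_image; last first.
  by move=> x y _ _; apply: hI.
case: leqP => kn; last first.
  by apply: fsbig1 => p _; rewrite /coef /qpow hk; case: eqP => //; lia.
apply: eq_fsbigr => p _; rewrite /coef /qpow hk; congr (_%:R).
by apply/eqP/eqP; lia.
Qed.

Lemma gf_add_part k A : (0 < k)%N -> gf (add_part k @` A) = qpow k * gf A.
Proof.
by move=> k0; apply: gf_image (add_part_inj k0) => p; apply: psize_add_part.
Qed.

(** Removing one occurrence of [k] is a bijection from the partitions having [k]
    as a part onto all partitions with parts in [P]; subtracting them leaves the
    partitions that avoid [k]. *)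
Lemma gf_remove (P Q : pred nat) k : (0 < k)%N -> P k ->
    (forall i, Q i = P i && (i != k)) ->
  (1 - qpow k) * gf [set p | all P (parts p)] = gf [set p | all Q (parts p)].
Proof.
move=> k0 Pk QP; rewrite mulrBl mul1r -gf_add_part //.
apply/eqP; rewrite subr_eq -gfU; last first.
  apply/seteqP; split => // p [/allP Qp [r _ rp]].
  have /Qp : k \in parts p.
    by rewrite -rp (perm_mem (perm_add_part r k0)) inE eqxx.
  by rewrite QP eqxx andbF.
apply/eqP; congr gf; apply/seteqP; split => p /=.
  move=> Pp; case: (boolP (k \in parts p)) => [/mem_part[r rp]|kp]; last first.
    left; apply/allP => i ip; rewrite QP (allP Pp) //=.
    by apply: contraNneq kp => <-.
  right; exists r => //; move: Pp.
  by rewrite -rp (perm_all _ (perm_add_part r k0)) => /andP[].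
case=> [|[r Pr <-]].
  by apply: sub_all => i; rewrite QP => /andP[].
by rewrite (perm_all _ (perm_add_part r k0)) /= Pk.
Qed.

Definition parts_in (m n : nat) : set partition :=
  [set p | all (fun i => m <= i < n)%N (parts p)].

Lemma gf_parts_in_recr m n : (0 < n)%N -> (m <= n)%N ->
  (1 - qpow n) * gf (parts_in m n.+1) = gf (parts_in m n).
Proof. by move=> n0 mn; apply: gf_remove => // [|i]; lia. Qed.

Lemma gf_parts_in_recl m n : (0 < m)%N -> (m < n)%N ->
  (1 - qpow m) * gf (parts_in m n) = gf (parts_in m.+1 n).
Proof. by move=> m0 mn; apply: gf_remove => // [|i]; lia. Qed.

Lemma gf_parts_in_geom m n : (0 < m)%N -> (m < n)%N ->
  gf (parts_in m n) = geom m * gf (parts_in m.+1 n).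
Proof.
move=> m0 mn; rewrite -gf_parts_in_recl // mulrA [geom m * _]mulrC.
by rewrite geomP ?mul1r.
Qed.

Lemma empty_partP : is_partition [::]. Proof. by []. Qed.

Lemma gf_parts_in_low m n i : (i < m)%N -> gf (parts_in m n) i = (i == 0)%:R.
Proof.
move=> im; case: posnP => [->|i0]; last first.
  apply: gf_coef0 => p /= /allP mp; apply: contraTneq im => ep.
  have sp : smallest p \in parts p by apply: smallest_mem; rewrite /mho /= ep.
  by have := mp _ sp; have := part_le_psize sp; lia.
rewrite gf_coefE (_ : _ `&` _ = [set Partition empty_partP]) ?fsbig_set1 //.
apply/seteqP; split => p /=; last by move->.
by case=> _ /psize_eq0 p0; apply: val_inj.
Qed.

Lemma gf_parts_in_nil m : gf (parts_in m m) = 1.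
Proof.
apply/funext => n; have -> : parts_in m m = parts_in n.+1 n.+1.
  by apply/seteqP; split => p; apply: sub_all => i; lia.
exact: gf_parts_in_low.
Qed.

(** * Bounded difference between largest and smallest parts *)

(** Removing one part equal to the smallest one leaves an arbitrary, possibly
    empty, partition with parts between [s] and [s + L]. *)
Lemma smallest_setE L s : (0 < s)%N ->
  [set p | [/\ mho p, smallest p = s & (largest p - smallest p <= L)%N]] =
  add_part s @` parts_in s (s + L).+1.
Proof.
move=> s0; apply/seteqP; split => p /=.
  case=> p0 ps pL; have sp : s \in parts p by rewrite -ps smallest_mem.
  have [r rp] := mem_part sp; exists r => //; apply/allP => i ir.
  have ip : i \in parts p.
    by rewrite -rp (perm_mem (perm_add_part r s0)) inE ir orbT.
  by have := smallest_le_part ip; have := part_le_largest ip; lia.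
case=> r /allP rs rp.
have pr : perm_eq p (s :: r) by rewrite -rp perm_add_part.
have sp : s \in parts p by rewrite (perm_mem pr) mem_head.
have bnd i : i \in parts p -> (s <= i <= s + L)%N.
  by rewrite (perm_mem pr) inE => /predU1P[->|/rs]; lia.
have p0 := mho_mem sp; split => //.
  by have := bnd _ (smallest_mem p0); have := smallest_le_part sp; lia.
by have := bnd _ (smallest_mem p0); have := bnd _ (largest_mem p0); lia.
Qed.

Lemma gf_smallest L s : (0 < s)%N ->
  gf [set p | [/\ mho p, smallest p = s & (largest p - smallest p <= L)%N]] =
  qpow s * gf (parts_in s (s + L).+1).
Proof. by move=> s0; rewrite smallest_setE // gf_add_part. Qed.

Definition bounded_diff (L m : nat) : set partition :=
  [set p | [/\ mho p, (m <= smallest p)%N & (largest p - smallest p <= L)%N]].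

Lemma gf_bounded_diffS L m : (0 < m)%N -> gf (bounded_diff L m) =
  qpow m * gf (parts_in m (m + L).+1) + gf (bounded_diff L m.+1).
Proof.
move=> m0; rewrite -gf_smallest // -gfU; last first.
  by apply/seteqP; split => // p [[_ pm _] [_ + _]]; rewrite pm ltnn.
congr gf; apply/seteqP; split => p /=.
  by case=> p0; rewrite leq_eqVlt => /predU1P[<- pL|mp pL]; [left | right].
by case=> -[p0 pm pL]; split => //; [rewrite pm | apply: ltnW].
Qed.

(** Telescoping: the difference [defect m] of the two sides does not change when
    [m] is replaced by [m + 1], and all its coefficients of degree below [m]
    vanish, so it is zero. *)
Lemma gf_bounded_diff L m : (0 < m)%N ->
  (1 - qpow L) * gf (bounded_diff L m) = gf (parts_in m (m + L)) - 1.
Proof.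
pose defect k :=
  (1 - qpow L) * gf (bounded_diff L k) - gf (parts_in k (k + L)) + 1.
move=> m0; apply/eqP; rewrite -subr_eq0 opprB addrA addrAC -/(defect m); apply/eqP.
have defectS k : (0 < k)%N -> defect k = defect k.+1.
  move=> k0; rewrite /defect gf_bounded_diffS // addSn.
  (* Both interval series are expressed by the one with parts in [k, k + L]. *)
  rewrite -(gf_parts_in_recl k0) ?ltnS ?leq_addr //.
  rewrite -(@gf_parts_in_recr k (k + L)) ?addn_gt0 ?k0 ?leq_addr // qpowD.
  ring.
have defectD k : defect m = defect (m + k)%N.
  elim: k => [|k ->]; first by rewrite addn0.
  by rewrite addnS defectS // addn_gt0 m0.
apply/funext => n; rewrite (defectD n.+1) {defectS defectD}.
have low i : (i <= n)%N -> gf (bounded_diff L (m + n.+1)) i = 0.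
  move=> ilen; apply: gf_coef0 => p [p0 mp _].
  by have := part_le_psize (smallest_mem p0); lia.
rewrite /defect fpsD fpsD fpsN gf_parts_in_low; last by lia.
rewrite mulrBl mul1r fpsD fpsN qpow_mulE !low ?leq_subr // if_same subrr add0r.
exact: addNr.
Qed.

Lemma GE L s : (0 < s)%N ->
  G L s = qpow s * gf (parts_in s (s + L).+1) - gf (bounded_diff L s.+1).
Proof. by move=> s0; rewrite -gf_smallest. Qed.

(** * Nonnegativity *)

(** Once denominators are cleared this is an identity between polynomials in
    [q].  The right-hand side is one solution of the linear feasibility problem
    of writing the left-hand side with nonnegative multipliers. *)
Lemma corrected_series_identity (A : comNzRingType) (q a2 a3 a4 a5 a6 : A) :
    (1 - q ^+ 2) * a2 = 1 -> (1 - q ^+ 3) * a3 = 1 -> (1 - q ^+ 4) * a4 = 1 ->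
    (1 - q ^+ 5) * a5 = 1 -> (1 - q ^+ 6) * a6 = 1 ->
  q ^+ 2 * (a2 * a3 * a4 * a5) - a3 * (a3 * a4 * a5 - 1)
    + q ^+ 3 + q ^+ 9 + q ^+ 15 =
  q ^+ 2 + q ^+ 10 * (a4 * a6) + q ^+ 14 * (a3 * a5) + q ^+ 26 * (a5 * a6)
    + q ^+ 17 * (a3 * a5 * a6) + q ^+ 25 * (a4 * a5 * a6)
    + q ^+ 16 * (a3 * a4 * a5 * a6).
Proof.
set b2 := 1 - q ^+ 2; set b3 := 1 - q ^+ 3; set b4 := 1 - q ^+ 4.
set b5 := 1 - q ^+ 5; set b6 := 1 - q ^+ 6.
move=> e2 e3 e4 e5 e6; apply/eqP; rewrite -subr_eq0; apply/eqP.
(* The difference of the two sides over the common denominator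
   b2 b3^2 b4 b5 b6, where b3 is squared because of the term a3^2. *)
transitivity ((q ^+ 2 * (b3 * b6) - b2 * b6 + b2 * b3 * b4 * b5 * b6
    + (q ^+ 3 + q ^+ 9 + q ^+ 15 - q ^+ 2) * (b2 * b3 ^+ 2 * b4 * b5 * b6)
    - q ^+ 10 * (b2 * b3 ^+ 2 * b5) - q ^+ 14 * (b2 * b3 * b4 * b6)
    - q ^+ 26 * (b2 * b3 ^+ 2 * b4) - q ^+ 17 * (b2 * b3 * b4)
    - q ^+ 25 * (b2 * b3 ^+ 2) - q ^+ 16 * (b2 * b3)) *
    (a2 * a3 ^+ 2 * a4 * a5 * a6)).
  by ring: e2 e3 e4 e5 e6.
by rewrite /b2 /b3 /b4 /b5 /b6; ring.
Qed.

Theorem theorem20 :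
  forall n : nat, 0 <= coef (G 3 2 + qpow 3 + qpow 9 + qpow 15) n.
Proof.
suff: nonneg (G 3 2 + qpow 3 + qpow 9 + qpow 15) by [].
have second_sum :
    gf (bounded_diff 3 3) = geom 3 * (geom 3 * geom 4 * geom 5 - 1).
  transitivity (geom 3 * ((1 - qpow 3) * gf (bounded_diff 3 3))).
    by rewrite mulrA [geom 3 * _]mulrC geomP // mul1r.
  rewrite gf_bounded_diff //; do 3 rewrite gf_parts_in_geom //.
  by rewrite gf_parts_in_nil mulr1 !mulrA.
rewrite GE // second_sum; do 4 rewrite gf_parts_in_geom //.
rewrite gf_parts_in_nil mulr1 !mulrA.
have := @corrected_series_identity _ (qpow 1)
  (geom 2) (geom 3) (geom 4) (geom 5) (geom 6).
rewrite -!qpowE !geomP // !mulrA => -> //.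
by do ![apply: nonnegD | apply: nonnegM
       | apply: nonneg_qpow | apply: nonneg_geom].
Qed.
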